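(* Let $G$ be a noncomplete graph. Then (i) $\overline{e}pa(G) \leq 3$ if and only if there is a pair of nonadjacent (distinct) vertices $u$ and $v$ of $G$ such that neither of the following two conditions is valid: ''$u \in V^-(G)$ and $v$ is a $\gamma$-good vertex of $G-u$''; ''$v \in V^-(G)$ and $u$ is a $\gamma$-good vertex of $G-v$''. (ii) $\overline{e}pa(G) = \overline{E}pa(G) = 3$ if and only if all vertices of $G$ are $\gamma$-good, $V^-(G)$ is empty, and for every two nonadjacent vertices $u$ and $v$ of $G$ there is a $\gamma$-set of $G$ which contains them both.
   Context: Graphs are finite and simple. $\gamma(H)$ denotes the domination number of a graph $H$; a $\gamma$-set of $H$ is a dominating set of $H$ of cardinality $\gamma(H)$. A vertex of $H$ is a $\gamma$-good vertex of $H$ if it belongs to some $\gamma$-set of $H$. $V^-(H) = \{x \in V(H) \mid \gamma(H-x) < \gamma(H)\}$. For distinct vertices $u,v$ of $G$ and an integer $k\geq 0$, $G_{u,v,k}$ denotes the graph obtained from the disjoint union of $G$ and a path $x_0,x_1,\dots,x_{k+1}$ by identifying $u$ with $x_0$ and $v$ with $x_{k+1}$ (so $k$ new vertices are added; for nonadjacent $u,v$, $G_{u,v,0}$ is $G$ with the edge $uv$ added). $pa(u,v)$ is the minimum integer $k\geq 0$ such that $\gamma(G) < \gamma(G_{u,v,k})$. $\overline{e}pa(G)$ and $\overline{E}pa(G)$ are, respectively, the minimum and the maximum of $pa(u,v)$ over all pairs of distinct nonadjacent vertices $u,v$ of $G$. *)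

(* Defs.v *)
From mathcomp Require Import all_boot zify.

Set Implicit Arguments.
Unset Strict Implicit.
Unset Printing Implicit Defensive.

Structure sgraph := SGraph {
  svertex :> finType;
  sedge : rel svertex;
  sedge_sym : symmetric sedge;
  sedge_irrefl : irreflexive sedge }.

Declare Scope sgraph_scope.
Open Scope sgraph_scope.
Notation "x -- y" := (sedge x y) (at level 30) : sgraph_scope.

Definition nonadjacent (G : sgraph) (u v : G) : bool := (u != v) && ~~ (u -- v).

Definition noncomplete (G : sgraph) : bool :=
  [exists u : G, exists v : G, nonadjacent u v].

Definition dominating (G : sgraph) (D : {set G}) : bool :=
  [forall v, (v \in D) || [exists u in D, u -- v]].

Definition gamma (G : sgraph) : nat :=
  #|[arg min_(D < [set: G] | dominating D) #|D| ]|.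

Definition gamma_set (G : sgraph) (D : {set G}) : bool :=
  dominating D && (#|D| == gamma G).

Definition good (G : sgraph) : {set G} :=
  [set v | [exists D : {set G}, gamma_set D && (v \in D)]].

Section DeleteVertex.
Variables (G : sgraph) (x : G).

Definition del_rel : rel {y : G | y != x} := fun a b => sval a -- sval b.

Fact del_sym : symmetric del_rel.
Proof. by move=> a b; rewrite /del_rel sedge_sym. Qed.

Fact del_irrefl : irreflexive del_rel.
Proof. by move=> a; rewrite /del_rel sedge_irrefl. Qed.

Definition del_vertex : sgraph := SGraph del_sym del_irrefl.

(* The good vertices of G - x, seen as vertices of G. *)
Definition good_del : {set G} := [set sval w | w in good del_vertex].

End DeleteVertex.

Definition Vminus (G : sgraph) : {set G} :=
  [set x : G | gamma (del_vertex x) < gamma G].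

Section AddPath.
Variables (G : sgraph) (u v : G) (k : nat).

(* The vertices x_0 = u, x_1, ..., x_k, x_{k+1} = v of the path, the new vertex
   x_{i+1} being inr i; only the indices m <= k+1 are meaningful. *)
Definition path_vertex (m : nat) : G + 'I_k :=
  if m is i.+1 then
    if insub i is Some j then inr j else inl v
  else inl u.

Definition path_step (a b : G + 'I_k) : bool :=
  [exists m : 'I_k.+1, (a == path_vertex m) && (b == path_vertex m.+1)].

Definition old_edge (a b : G + 'I_k) : bool :=
  match a, b with inl a', inl b' => a' -- b' | _, _ => false end.

(* The guard a != b is only relevant in the degenerate case u = v, k = 0. *)
Definition add_path_rel : rel (G + 'I_k) :=
  fun a b => (a != b) && [|| old_edge a b, path_step a b | path_step b a].

Fact add_path_sym : symmetric add_path_rel.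
Proof.
move=> a b; rewrite /add_path_rel eq_sym [path_step b a || _]orbC orbCA orbC.
by rewrite orbC orbCA; case: a b => [a|a] [b|b] //=; rewrite sedge_sym.
Qed.

Fact add_path_irrefl : irreflexive add_path_rel.
Proof. by move=> a; rewrite /add_path_rel eqxx. Qed.

Definition add_path : sgraph := SGraph add_path_sym add_path_irrefl.

End AddPath.

Lemma gamma_witness (G : sgraph) :
  exists2 D : {set G}, dominating D & #|D| = gamma G.
Proof.
rewrite /gamma; case: arg_minnP => [|D domD _]; last by exists D.
by apply/forallP => v; rewrite inE.
Qed.

Lemma pa_subproof (G : sgraph) (u v : G) :
  exists k, gamma G < gamma (add_path u v k).
Proof.
set n := gamma G; pose k := 3 * n.+1; exists k.
have [D /forallP domD <-] := gamma_witness (add_path u v k).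
have ltk (j : 'I_n.+1) : 3 * j + 1 < k by have := ltn_ord j; rewrite /k; lia.
pose c j : add_path u v k := inr (Ordinal (ltk j)).
pose near j (w : add_path u v k) :=
  if w is inr i then 3 * j <= i < 3 * j + 3 else false.
have ex_near (j : 'I_n.+1) : exists w, (w \in D) && near j w.
  case/orP: (domD (c j)) => [cD|].
    by exists (c j); rewrite cD /near /=; lia.
  case/existsP => w /andP[wD adj]; exists w; rewrite wD /=.
  have pv m : m <= k.+1 -> path_vertex u v k m = c j -> m = 3 * j + 2.
    case: m => [|i] //= _; case: insubP => // i' _ <- [->] /=; lia.
  have near_pv m : 3 * j < m < 3 * j + 4 -> near j (path_vertex u v k m).
    case: m => [|i] /= hm; first lia.
    case: insubP => [i' _ /= ->|]; first lia.
    have := ltk j; have := ltn_ord j; rewrite /k; lia.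
  case/andP: adj => _ /or3P[| |].
  - by case: (w).
  - case/existsP=> m /andP[/eqP -> /eqP/esym /pv e]; apply: near_pv.
    have := ltn_ord m; have := e; lia.
  - case/existsP=> m /andP[/eqP/esym /pv e /eqP ->]; apply: near_pv.
    have := ltn_ord m; have := e; lia.
pose f j := xchoose (ex_near j).
have fP j : (f j \in D) && near j (f j) := xchooseP (ex_near j).
have f_inj : injective f.
  move=> i j eqf; have /andP[_] := fP i; have /andP[_] := fP j.
  rewrite eqf /near; case: (f j) => // z; move=> h1 h2; apply: val_inj => /=.
  lia.
rewrite -[n.+1]card_ord -(card_imset _ f_inj); apply: subset_leq_card.
by apply/subsetP => _ /imsetP[j _ ->]; case/andP: (fP j).
Qed.

(* Total in u and v; the cases u = v and u -- v are never used. *)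
Definition pa (G : sgraph) (u v : G) : nat := ex_minn (pa_subproof u v).

Lemma epa_subproof (G : sgraph) : noncomplete G ->
  exists k, [exists u : G, exists v : G, nonadjacent u v && (pa u v == k)].
Proof.
case/existsP=> u /existsP[v uv]; exists (pa u v).
by apply/existsP; exists u; apply/existsP; exists v; rewrite uv eqxx.
Qed.

Definition epa (G : sgraph) (ncG : noncomplete G) : nat :=
  ex_minn (epa_subproof ncG).

(* For a noncomplete graph the range is nonempty, so the default 0 plays no role. *)
Definition Epa (G : sgraph) : nat :=
  \max_(p : G * G | nonadjacent p.1 p.2) pa p.1 p.2.

(* Main.v *)
(* Let u, v be nonadjacent, and let D be a dominating set of G_{u,v,3} with at
   most gamma(G) elements. If D contains only x_1 (resp. x_3) among the new
   vertices, its trace on G contains v (resp. u) and dominates all of G except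
   u (resp. v); it cannot contain x_2 only; and if it contains two of them, its
   trace together with u dominates all of G except v. Hence pa(u,v) > 3 iff
   fewer than gamma(G) vertices, one of u, v among them, dominate everything but
   the other, that is, iff one of the two conditions in (i) holds.
   For (ii), a minimum dominating set of G - u with fewer than gamma(G) elements
   avoids the neighbours of u, so each of its elements v is nonadjacent to u
   with pa(u,v) > 3; thus V^-(G) is empty, and gamma(G_{u,v,2}) <= gamma(G) then
   forces a gamma-set containing u and v. *)
Require Import Defs.
From mathcomp Require Import all_boot zify.

Set Implicit Arguments.
Unset Strict Implicit.
Unset Printing Implicit Defensive.

(** * Domination of single vertices, and deletion of a vertex *)

Definition dominates (G : sgraph) (A : {set G}) (x : G) : bool :=
  (x \in A) || [exists y in A, y -- x].

Lemma dominates_sub (G : sgraph) (A B : {set G}) x :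
  A \subset B -> dominates A x -> dominates B x.
Proof.
move=> /subsetP AB /orP[/AB xB|/existsP[y /andP[/AB yB xy]]]; first exact/orP/or_introl.
by apply/orP; right; apply/existsP; exists y; rewrite yB.
Qed.

Lemma dominatingP (G : sgraph) (A : {set G}) :
  reflect (forall x, dominates A x) (dominating A).
Proof. exact: forallP. Qed.

Lemma gamma_min (G : sgraph) (A : {set G}) : dominating A -> gamma G <= #|A|.
Proof.
move=> domA; rewrite /gamma; case: arg_minnP => [|D _]; last exact.
by apply/dominatingP => x; rewrite /dominates inE.
Qed.

Lemma gamma_dominates_all_but (G : sgraph) (u : G) (A : {set G}) :
  (forall x, x != u -> dominates A x) -> dominates A u -> gamma G <= #|A|.
Proof.
move=> dA du; apply/gamma_min/dominatingP => x.
by have [->|/dA] := eqVneq x u.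
Qed.

Lemma gamma_del_witness (G : sgraph) (u : G) (D : {set del_vertex u}) :
  dominating D -> forall x, x != u -> dominates (sval @: D) x.
Proof.
move=> /dominatingP dD x xu; case/orP: (dD (exist _ x xu)) => [xD|].
  by apply/orP; left; apply/imsetP; exists (exist _ x xu).
case/existsP=> y /andP[yD xy]; apply/orP; right; apply/existsP.
by exists (sval y); rewrite imset_f.
Qed.

Lemma card_sval (G : sgraph) (u : G) (D : {set del_vertex u}) :
  #|sval @: D| = #|D|.
Proof. by rewrite card_imset //; apply: val_inj. Qed.

(** Adding [u] to a minimum dominating set of [G - u] dominates [G]. *)
Lemma gamma_del_ge (G : sgraph) (u : G) : gamma G <= (gamma (del_vertex u)).+1.
Proof.
have [D domD <-] := gamma_witness (del_vertex u).
rewrite -card_sval; apply: (@leq_trans #|u |: (sval @: D)|).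
  apply: (@gamma_dominates_all_but _ u) => [x xu|].
    exact: dominates_sub (subsetUr _ _) (gamma_del_witness domD xu).
  by rewrite /dominates setU11.
by rewrite cardsU1; lia.
Qed.

(** A set this small cannot dominate [u] as well, so it avoids [u] and lives in [G - u]. *)
Lemma del_vertex_lift (G : sgraph) (u : G) (A : {set G}) :
  #|A| < gamma G -> (forall x, x != u -> dominates A x) ->
  exists2 D : {set del_vertex u}, dominating D & sval @: D = A.
Proof.
move=> ltA dA; have uA : u \notin A.
  apply/negP=> uA; have := @gamma_dominates_all_but _ u A dA.
  by rewrite /dominates uA; lia.
exists [set w | sval w \in A].
  apply/dominatingP=> -[x xu]; rewrite /dominates inE /=.
  case/orP: (dA x xu) => [-> //|/existsP[y /andP[yA xy]]].
  have yu : y != u by apply: contraNneq uA => <-.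
  by apply/orP; right; apply/existsP; exists (exist _ y yu); rewrite inE yA.
apply/setP=> x; apply/imsetP/idP => [[w] + -> |xA]; first by rewrite inE.
have xu : x != u by apply: contraNneq uA => <-.
by exists (exist _ x xu); rewrite ?inE.
Qed.

Lemma VminusP (G : sgraph) (u : G) :
  u \in Vminus G <->
  exists2 A : {set G}, #|A| < gamma G & forall x, x != u -> dominates A x.
Proof.
rewrite inE; split=> [|[A ltA dA]].
  have [D domD <-] := gamma_witness (del_vertex u) => ltD.
  by exists (sval @: D); [rewrite card_sval | apply: gamma_del_witness].
have [D domD eqD] := del_vertex_lift ltA dA.
by apply: leq_ltn_trans ltA; rewrite -eqD card_sval gamma_min.
Qed.

(** Restates a condition of (i) inside [G]. Since deleting [u] lowers the domination number by at
    most one, any such [A] is a minimum dominating set of [G - u]. *)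
Lemma Vminus_goodP (G : sgraph) (u v : G) :
  (u \in Vminus G /\ v \in good_del u) <->
  exists A : {set G},
    [/\ #|A| < gamma G, v \in A & forall x, x != u -> dominates A x].
Proof.
split=> [[]|[A [ltA vA dA]]].
  rewrite inE => ltu /imsetP[w]; rewrite inE => /existsP[D] /andP[].
  move=> /andP[domD /eqP cD] wD ->; exists (sval @: D).
  by rewrite card_sval cD imset_f //; split=> //; apply: gamma_del_witness.
split; first by apply/VminusP; exists A.
have [D domD eqD] := del_vertex_lift ltA dA.
move: vA; rewrite -eqD => /imsetP[w wD ->]; apply: imset_f.
rewrite inE; apply/existsP; exists D.
rewrite wD andbT /gamma_set domD /= eqn_leq gamma_min // andbT.
by have := gamma_del_ge u; rewrite -card_sval eqD; lia.
Qed.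

(** * Adjacency in [G] with an attached path, and traces of its dominating sets *)

Section AddPathAdjacency.
Variables (G : sgraph) (u v : G).

(** All indices beyond [k], not only [k.+1], are sent to [v]; hence [k < m]. *)
Lemma path_vertex_inl k (a : G) (m : nat) :
  (inl a == path_vertex u v k m) =
  ((m == 0) && (a == u)) || ((k < m) && (a == v)).
Proof.
case: m => [|i] /=; first by rewrite orbF.
case: insubP => [j ij _|]; first by rewrite ltnS leqNgt ij.
by rewrite -leqNgt ltnS => ->.
Qed.

Lemma path_vertex_inr k (j : 'I_k) (m : nat) :
  (inr j == path_vertex u v k m) = (m == j.+1).
Proof.
case: m => [|i] //=; rewrite eqSS.
case: insubP => [j' _ <-|ki]; first by rewrite eq_sym.
by apply/esym/eqP => e; move: ki; rewrite e ltn_ord.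
Qed.

(** With at least one new vertex, no step of the path joins two old vertices; the length 0 adds the
    edge [uv] and is treated apart. *)
Lemma add_path_inl_inl k (a b : G) :
  (inl a : add_path u v k.+1) -- inl b = a -- b.
Proof.
rewrite /= /add_path_rel /=.
have no_step (x y : G) : path_step u v (inl x : G + 'I_k.+1) (inl y) = false.
  apply/existsP => -[m]; have := ltn_ord m; rewrite !path_vertex_inl; lia.
rewrite !no_step !orbF; have [e|_] /= := eqVneq (inl a : G + 'I_k.+1) (inl b).
  by case: e => ->; rewrite sedge_irrefl.
by [].
Qed.

Lemma add_path_inl_inr k (a : G) (j : 'I_k.+1) :
  (inl a : add_path u v k.+1) -- inr j =
  ((a == u) && (j == ord0)) || ((a == v) && (j == ord_max)).
Proof.
rewrite /= /add_path_rel /= -!val_eqE /=; have jk := ltn_ord j.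
apply/orP/orP => [[] /existsP[m]|[]/andP[/eqP -> /eqP je]].
- rewrite path_vertex_inl path_vertex_inr; have := ltn_ord m; lia.
- rewrite path_vertex_inl path_vertex_inr; have := ltn_ord m; lia.
- left; apply/existsP; exists ord0.
  by rewrite path_vertex_inl path_vertex_inr je eqxx.
- right; apply/existsP; exists ord_max.
  by rewrite path_vertex_inl path_vertex_inr /= je !eqxx ltnSn.
Qed.

Lemma add_path_inr_inr k (i j : 'I_k) :
  (inr i : add_path u v k) -- inr j = (i.+1 == j) || (j.+1 == i).
Proof.
have step (x y : 'I_k) : path_step u v (inr x) (inr y) = (x.+1 == y :> nat).
  apply/existsP/idP => [[m]|/eqP e].
    by rewrite !path_vertex_inr => /andP[/eqP -> /eqP[->]].
  have xk : x.+1 < k.+1 by rewrite ltnS.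
  by exists (Ordinal xk); rewrite !path_vertex_inr /= e !eqxx.
rewrite /= /add_path_rel /= !step.
have [[->]|//] := eqVneq (inr i : G + 'I_k) (inr j).
by rewrite /=; lia.
Qed.

Lemma card_inl_inr k (D : {set add_path u v k}) :
  #|D| = #|[set a | inl a \in D]| + #|[set j | inr j \in D]|.
Proof.
by rewrite -!sum1_card big_sumType /=; congr (_ + _); apply: eq_bigl => x; rewrite inE.
Qed.

(* [A] and [B] are the traces of a dominating set on [G] and on the new vertices. *)
Lemma gamma_add_pathP k n :
  gamma (add_path u v k.+1) <= n <->
  exists (A : {set G}) (B : {set 'I_k.+1}),
    [/\ #|A| + #|B| <= n,
        forall x, [|| dominates A x, (x == u) && (ord0 \in B)
                    | (x == v) && (ord_max \in B)]
      & forall j, [|| j \in B, [exists i in B, (i.+1 == j) || (j.+1 == i)],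
                    (j == ord0) && (u \in A) | (j == ord_max) && (v \in A)]].
Proof.
split=> [|[A [B [len domA domB]]]].
  have [D /dominatingP domD <-] := gamma_witness (add_path u v k.+1).
  exists [set a | inl a \in D], [set j | inr j \in D].
  rewrite -card_inl_inr; split=> // [x|j].
    rewrite /dominates !inE; case/orP: (domD (inl x)) => [->//|/existsP[[y|j]]].
      rewrite add_path_inl_inl => /andP[yD xy].
      by rewrite (_ : [exists _ in _, _]) ?orbT //; apply/existsP; exists y; rewrite inE yD.
    rewrite sedge_sym add_path_inl_inr => /andP[jD /orP[]/andP[-> /eqP je]];
      by rewrite -je jD !orbT.
  rewrite !inE; case/orP: (domD (inr j)) => [->//|/existsP[[y|i]]].
    rewrite add_path_inl_inr => /andP[yD /orP[]/andP[/eqP <- ->]];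
      by rewrite yD !orbT.
  rewrite add_path_inr_inr => /andP[iD ij].
  by rewrite (_ : [exists _ in _, _]) ?orbT //; apply/existsP; exists i; rewrite inE iD.
pose D : {set add_path u v k.+1} :=
  [set w | match w with inl a => a \in A | inr j => j \in B end].
apply: leq_trans len; rewrite (_ : #|A| + #|B| = #|D|); last first.
  by rewrite card_inl_inr; congr (_ + _); apply: eq_card => x; rewrite !inE.
apply/gamma_min/dominatingP=> -[x|j]; rewrite /dominates inE.
  case/or3P: (domA x) => [/orP[->//|/existsP[y /andP[yA xy]]]|/andP[xu jB]|/andP[xv jB]];
    apply/orP; right; apply/existsP.
  - by exists (inl y); rewrite inE yA add_path_inl_inl.
  - by exists (inr ord0); rewrite inE jB sedge_sym add_path_inl_inr xu eqxx.
  - by exists (inr ord_max); rewrite inE jB sedge_sym add_path_inl_inr xv eqxx orbT.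
case/or4P: (domB j) => [->//|/existsP[i /andP[iB ij]]|/andP[je xA]|/andP[je xA]];
  apply/orP; right; apply/existsP.
- by exists (inr i); rewrite inE iB add_path_inr_inr.
- by exists (inl u); rewrite inE xA add_path_inl_inr je eqxx.
- by exists (inl v); rewrite inE xA add_path_inl_inr je eqxx orbT.
Qed.

End AddPathAdjacency.

(** * Domination with an attached path, and the value of [pa] *)

Lemma gamma_add_path0 (G : sgraph) (u v : G) : gamma (add_path u v 0) <= gamma G.
Proof.
have [D /dominatingP domD <-] := gamma_witness G.
have injl : injective (@inl G 'I_0) by move=> x y [].
rewrite -(card_imset (mem D) injl); apply/gamma_min/dominatingP => -[x|[]//].
rewrite /dominates (mem_imset _ _ injl).
case/orP: (domD x) => [->//|/existsP[y /andP[yD xy]]]; apply/orP; right.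
apply/existsP; exists (inl y); rewrite (mem_imset _ _ injl) yD /= /add_path_rel /= xy andbT.
(* The ends of an edge are distinct, so old edges pass the guard of [add_path_rel]. *)
by apply: contraTneq xy => -[->]; rewrite sedge_irrefl.
Qed.

Lemma pa_gt (G : sgraph) (u v : G) n :
  n < pa u v <-> forall k, k <= n -> gamma (add_path u v k) <= gamma G.
Proof.
rewrite /pa; case: ex_minnP => m gm minm; split=> [nm k kn|h].
  by rewrite leqNgt; apply/negP => /minm; lia.
by rewrite ltnNge; apply/negP => /h; rewrite leqNgt gm.
Qed.

Section AddPathDomination.
Variables (G : sgraph) (u v : G).

(** Add x_1 to [A]: it dominates [u], itself and x_2, while [v] dominates x_k. For [k <= 3] this
    covers the whole path. *)
Lemma gamma_add_path_critical_l (A : {set G}) k :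
  k <= 3 -> #|A| < gamma G -> v \in A -> (forall x, x != u -> dominates A x) ->
  gamma (add_path u v k) <= gamma G.
Proof.
case: k => [|k] k3 ltA vA dA; first exact: gamma_add_path0.
apply/gamma_add_pathP; exists A, [set ord0]; split=> [|x|j].
- by rewrite cards1 addn1.
- by have [->|/dA ->//] := eqVneq x u; rewrite set11 orbT.
rewrite inE vA andbT; case: (ltngtP j 1) => [j0|j2|j1].
- by rewrite -val_eqE /= (_ : (j == 0 :> nat)); last lia.
- have := ltn_ord j => jk; rewrite (_ : j == ord_max) ?orbT //.
  by apply/eqP/val_inj => /=; lia.
- by apply/or4P/Or42/existsP; exists ord0; rewrite set11 j1.
Qed.

(** The mirror image, with x_k in place of x_1. *)
Lemma gamma_add_path_critical_r (A : {set G}) k :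
  k <= 3 -> #|A| < gamma G -> u \in A -> (forall x, x != v -> dominates A x) ->
  gamma (add_path u v k) <= gamma G.
Proof.
case: k => [|k] k3 ltA uA dA; first exact: gamma_add_path0.
apply/gamma_add_pathP; exists A, [set ord_max]; split=> [|x|j].
- by rewrite cards1 addn1.
- by have [->|/dA ->//] := eqVneq x v; rewrite set11 !orbT.
rewrite inE uA andbT; have jk := ltn_ord j; case: (ltngtP j.+1 k) => [j0|j2|j1].
- by rewrite (_ : j == ord0) ?orbT //; apply/eqP/val_inj => /=; lia.
- by rewrite (_ : j == ord_max) //; apply/eqP/val_inj => /=; lia.
- by apply/or4P/Or42/existsP; exists ord_max; rewrite set11 /= j1 eqxx orbT.
Qed.

(** On a path with at most two new vertices, each of them is adjacent to [u] or [v]. *)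
Lemma gamma_add_path_common (D : {set G}) k :
  k <= 2 -> gamma_set D -> u \in D -> v \in D ->
  gamma (add_path u v k) <= gamma G.
Proof.
case: k => [|k] k2 /andP[/dominatingP domD /eqP cD] uD vD.
  exact: gamma_add_path0.
apply/gamma_add_pathP; exists D, set0; split=> [|x|j].
- by rewrite cards0 addn0 cD.
- by rewrite domD.
rewrite uD vD !andbT -!val_eqE /=; have := ltn_ord j => jk.
by apply/or4P; case: (posnP j) => [->|]; [apply: Or43 | move=> ?; apply: Or44; lia].
Qed.

(** Handles dominating sets with two or more new vertices: there is room to put [u] into the
    trace. *)
Lemma critical_of_two (A : {set G}) :
  #|A|.+1 < gamma G ->
  (forall x, x != u -> x != v -> dominates A x) ->
  exists A' : {set G},
    [/\ #|A'| < gamma G, u \in A' & forall x, x != v -> dominates A' x].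
Proof.
move=> ltA dA; exists (u |: A); split; rewrite ?setU11 //.
  by apply: leq_ltn_trans ltA; rewrite cardsU1; lia.
move=> x xv; have [->|xu] := eqVneq x u; first by rewrite /dominates setU11.
exact: dominates_sub (subsetUr _ _) (dA x xu xv).
Qed.

(** Coding the chosen new vertices by [b] on [nat], with [b i] standing for x_{i+1}, turns a
    concrete [k] into a finite case analysis on booleans. *)
Lemma gamma_add_path_trace k n :
  gamma (add_path u v k.+1) <= n ->
  exists (A : {set G}) (b : nat -> bool),
    [/\ #|A| + \sum_(i < k.+1) b i <= n,
        forall x, [|| dominates A x, (x == u) && b 0 | (x == v) && b k]
      & forall j, j <= k ->
          [|| b j, (0 < j) && b j.-1, (j < k) && b j.+1, (j == 0) && (u \in A)
            | (j == k) && (v \in A)]].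
Proof.
case/gamma_add_pathP=> A [B [len domA domB]].
(* Beyond [k], [inord] falls back on [ord0], but the conclusion consults [b] only at indices up to
   [k]. *)
pose b m := inord m \in B.
have bE (i : 'I_k.+1) : (i \in B) = b i by rewrite /b inord_val.
exists A, b; split=> [|x|j jk].
- apply: leq_trans len; rewrite leq_add2l -sum1_card [leqRHS]big_mkcond /=.
  by apply: leq_sum => i _; rewrite bE; case: (b i).
- by have := domA x; rewrite !bE.
have jk1 : j < k.+1 by [].
have := domB (Ordinal jk1); rewrite bE -!val_eqE /=.
case/or4P=> [->//|/existsP[i]|->|->]; rewrite ?orbT //.
rewrite bE => /andP[bi /orP[]/eqP ij].
  by rewrite -ij /= bi orbT.
have jk' : j < k by have := ltn_ord i; lia.
by rewrite jk' ij bi !orbT.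
Qed.

Lemma gamma_add_path3 :
  gamma (add_path u v 3) <= gamma G ->
  (u \in Vminus G /\ v \in good_del u) \/ (v \in Vminus G /\ u \in good_del v).
Proof.
case/gamma_add_path_trace=> A [b [+ domA domB]]; rewrite !Vminus_goodP.
have dAuv x : x != u -> x != v -> dominates A x.
  by move=> /negbTE xu /negbTE xv; have := domA x; rewrite xu xv /= orbF.
have [lt2 _|ge2] := ltnP #|A|.+1 (gamma G).
  by right; apply: critical_of_two lt2 dAuv.
rewrite !big_ord_recl big_ord0 /= /bump /= addn0.
have := domB 0 isT; have := domB 1 isT; have := domB 2 isT => /=.
(* By [ge2] at most one new vertex is chosen, and x_2 needs a dominator on the path; so exactly one
   of x_1, x_2, x_3 remains. *)
case b0: (b 0); case b1: (b 1); case b2: (b 2) => //= h2 h1 h0 len;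
  try by exfalso; lia.
- left; exists A; split; [lia | by [] |].
  by move=> x /negbTE xu; have := domA x; rewrite xu b2 andbF /= orbF.
(* x_2 alone helps neither [u] nor [v], so [A] would dominate [G] with too few vertices. *)
- have : gamma G <= #|A|; last lia.
  by apply/gamma_min/dominatingP => x; have := domA x; rewrite b0 b2 !andbF /= orbF.
- right; exists A; split; [lia | by rewrite orbF in h0 |].
  by move=> x /negbTE xv; have := domA x; rewrite xv b0 andbF /= orbF.
Qed.

(** If x_1 or x_2 alone is chosen, the trace is below [gamma G] and can miss only [u] or only [v].
    If neither is, x_1 and x_2 must be dominated by [u] and [v]. *)
Lemma gamma_add_path2 :
  gamma (add_path u v 2) <= gamma G ->
  [\/ exists D : {set G}, [/\ gamma_set D, u \in D & v \in D],
      u \in Vminus G | v \in Vminus G].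
Proof.
case/gamma_add_path_trace=> A [b [+ domA domB]].
have dAuv x : x != u -> x != v -> dominates A x.
  by move=> /negbTE xu /negbTE xv; have := domA x; rewrite xu xv /= orbF.
have [lt2 _|ge2] := ltnP #|A|.+1 (gamma G).
  by have [A' [? _ ?]] := critical_of_two lt2 dAuv; apply: Or33; apply/VminusP; exists A'.
rewrite !big_ord_recl big_ord0 /= /bump /= addn0.
have := domB 0 isT; have := domB 1 isT => /=.
case b0: (b 0); case b1: (b 1) => //= h1 h0 len; try by exfalso; lia.
- apply: Or32; apply/VminusP; exists A => [|x /negbTE xu]; first lia.
  by have := domA x; rewrite xu b1 andbF /= orbF.
- apply: Or33; apply/VminusP; exists A => [|x /negbTE xv]; first lia.
  by have := domA x; rewrite xv b0 andbF /= orbF.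
- have domA' : dominating A.
    by apply/dominatingP => x; have := domA x; rewrite b0 b1 !andbF /= orbF.
  rewrite orbF in h0; apply: Or31; exists A; split=> //.
  by rewrite /gamma_set domA' eqn_leq gamma_min // andbT; lia.
Qed.

(** Forward, the bound at [k = 3] suffices; conversely one set [A] serves every [k <= 3]. *)
Lemma pa_gt3 :
  3 < pa u v <->
  (u \in Vminus G /\ v \in good_del u) \/ (v \in Vminus G /\ u \in good_del v).
Proof.
rewrite pa_gt; split=> [/(_ 3 isT)|]; first exact: gamma_add_path3.
rewrite !Vminus_goodP => -[] [A [ltA wA dA]] k k3.
  exact: gamma_add_path_critical_l dA.
exact: gamma_add_path_critical_r dA.
Qed.

End AddPathDomination.

(** * Extreme values of [pa], and the two equivalences *)

Lemma pa_le_Epa (G : sgraph) (u v : G) : nonadjacent u v -> pa u v <= Epa G.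
Proof. by move=> uv; apply: (leq_bigmax_cond (u, v)). Qed.

Lemma epa_le (G : sgraph) (ncG : noncomplete G) (u v : G) :
  nonadjacent u v -> epa ncG <= pa u v.
Proof.
move=> uv; rewrite /epa; case: ex_minnP => m _; apply.
by apply/existsP; exists u; apply/existsP; exists v; rewrite uv eqxx.
Qed.

Lemma epa_attained (G : sgraph) (ncG : noncomplete G) :
  exists u v : G, nonadjacent u v /\ pa u v = epa ncG.
Proof.
rewrite /epa; case: ex_minnP => m /existsP[u /existsP[v /andP[uv /eqP puv]]] _.
by exists u, v.
Qed.

Lemma epa_Epa_eq (G : sgraph) (ncG : noncomplete G) n :
  (epa ncG = n /\ Epa G = n) <-> forall u v : G, nonadjacent u v -> pa u v = n.
Proof.
split=> [[en En] u v uv|paE].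
  by have := pa_le_Epa uv; have := epa_le ncG uv; lia.
have [u [v [uv <-]]] := epa_attained ncG; split; first exact: paE.
apply/eqP; rewrite eqn_leq; apply/andP; split; last by rewrite -(paE u v uv) pa_le_Epa.
by apply/bigmax_leqP => -[x y] /= xy; rewrite paE.
Qed.

(** A set that dominates everything but [u] contains neither [u] nor a neighbour of [u], so any of
    its elements serves as [v]. *)
Lemma Vminus_nonadjacent_good (G : sgraph) (ncG : noncomplete G) (u : G) :
  u \in Vminus G -> exists2 v : G, nonadjacent u v & v \in good_del u.
Proof.
move=> uV; have [A ltA dA] := (VminusP u).1 uV.
have ndu : ~~ dominates A u.
  by apply/negP => /(gamma_dominates_all_but dA); lia.
(* A vertex other than [u] has to be dominated, which makes [A] nonempty. *)
have [w wu] : exists w, w != u.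
  case/existsP: (ncG) => x /existsP[y /andP[xy _]].
  by have [xu|] := eqVneq x u; [exists y; rewrite -xu eq_sym | exists x].
have [v vA] : exists v, v \in A.
  by case/orP: (dA w wu) => [|/existsP[v /andP[]]]; [exists w | exists v].
exists v; last by apply: ((Vminus_goodP u v).2 _).2; exists A.
move: ndu; rewrite negb_or => /andP[uA /existsPn/(_ v)]; rewrite vA /= => vu.
by rewrite /nonadjacent sedge_sym vu andbT; apply: contraNneq uA => ->.
Qed.

(** Here [gamma G] is 1. This covers the vertices that lie in no nonadjacent pair, about which [pa]
    says nothing. *)
Lemma good_of_universal (G : sgraph) (u : G) :
  (forall v, ~~ nonadjacent u v) -> u \in good G.
Proof.
move=> uniu; rewrite inE; apply/existsP; exists [set u].
have domu : dominating [set u].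
  apply/dominatingP=> x; rewrite /dominates inE; have [//|xu] := eqVneq x u.
  have := uniu x; rewrite /nonadjacent eq_sym xu negbK /= => ux.
  by apply/existsP; exists u; rewrite set11.
rewrite set11 andbT /gamma_set domu eqn_leq gamma_min // cards1 andbT.
have [D /dominatingP domD <-] := gamma_witness G.
rewrite card_gt0; apply/set0Pn.
by case/orP: (domD u) => [|/existsP[v /andP[]]]; [exists u | exists v].
Qed.

Theorem corollary18 (G : sgraph) (ncG : noncomplete G) :
  ((epa ncG <= 3) <->
   exists u v : G,
     [/\ nonadjacent u v,
         ~ (u \in Vminus G /\ v \in good_del u)
       & ~ (v \in Vminus G /\ u \in good_del v)])
  /\
  ((epa ncG = 3 /\ Epa G = 3) <->
   [/\ forall v : G, v \in good G,
       Vminus G = set0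
     & forall u v : G, nonadjacent u v ->
         exists D : {set G}, [/\ gamma_set D, u \in D & v \in D]]).
Proof.
have pa_le3 (u v : G) : pa u v <= 3 <->
    ~ (u \in Vminus G /\ v \in good_del u) /\
    ~ (v \in Vminus G /\ u \in good_del v).
  rewrite leqNgt; split=> [/negP|] npa.
    by split=> h; apply: npa; apply/pa_gt3; [left | right].
  by apply/negP => /pa_gt3[/npa.1|/npa.2].
split; first split=> [|[u [v [uv nu nv]]]].
- have [u [v [uv <-]]] := epa_attained ncG => /pa_le3[nu nv].
  by exists u, v.
- by apply: leq_trans (epa_le ncG uv) _; apply/pa_le3.
rewrite epa_Epa_eq; split=> [paE|[_ V0 common] u v uv].
  have V0 : Vminus G = set0.
    apply/setP => u; rewrite [RHS]inE; apply/negP => uV.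
    have [v uv vgood] := Vminus_nonadjacent_good ncG uV.
    by have [] : ~ 3 < pa u v; [rewrite paE | apply/pa_gt3; left].
  have common (u v : G) : nonadjacent u v ->
      exists D : {set G}, [/\ gamma_set D, u \in D & v \in D].
    (* The value 3 yields the bound at [k = 2]; with [Vminus G] empty, only the common set is
       left. *)
    move=> uv; have /pa_gt/(_ 2 isT) : 2 < pa u v by rewrite paE.
    by case/gamma_add_path2; rewrite // V0 inE.
  split=> // u; have [/existsP[v uv]|/existsPn/good_of_universal //] :=
    boolP [exists v, nonadjacent u v].
  have [D [gD uD _]] := common u v uv.
  by rewrite inE; apply/existsP; exists D; rewrite gD.
have [D [gD uD vD]] := common u v uv.
(* Emptiness of [Vminus G] bounds [pa u v] above by 3, and the common set bounds it below. *)
have le3 : pa u v <= 3 by apply/pa_le3; rewrite V0 !inE; split=> -[].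
have : 2 < pa u v; last lia.
by apply/pa_gt => k k2; apply: gamma_add_path_common gD uD vD.
Qed.
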